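(* Let $\mathbb{F}$ be a field of characteristic $2$. Let $t\in\mathbb{N}$, let $n\in\mathbb{N}$ and let $0\le k\le n$. Let $2^\tau$ be the least two-power appearing in the binary form of $t$. The sequence of $\mathbb{F}S_n$-modules $$\mathbb{F}\Omega_{k+t}\xrightarrow{\varphi^{(t)}_{k+t}}\mathbb{F}\Omega_k\xrightarrow{\varphi^{(t)}_k}\mathbb{F}\Omega_{k-t}$$ is exact (that is, $\ker\varphi^{(t)}_k=\operatorname{im}\varphi^{(t)}_{k+t}$) if and only if at least one of the following holds: (i) $t=1$; (ii) $k<2^\tau$ and $k+t\le n-k$, or $n-k<2^\tau$ and $n-k+t\le k$; (iii) $t$ is a two-power, and $n\ge 2k+t$ or $n\le 2k-t$.
   Context: $\mathbb{N}=\{1,2,\dots\}$. For $k\in\mathbb{Z}$, $\Omega_k$ is the set of $k$-subsets of $\{1,\dots,n\}$ (empty if $k<0$ or $k>n$), and $\mathbb{F}\Omega_k$ is the permutation $\mathbb{F}S_n$-module with basis $\Omega_k$. Maps are written on the right. The multistep boundary map $\varphi^{(t)}_k:\mathbb{F}\Omega_k\to\mathbb{F}\Omega_{k-t}$ is the $\mathbb{F}S_n$-homomorphism defined by $Y\varphi^{(t)}_k=\sum_{X\subseteq Y,\,|X|=k-t}X$ for $Y\in\Omega_k$. A two-power is a number $2^\beta$ with $\beta\ge 0$; $2^\beta$ appears in the binary form of $t$ if the coefficient of $2^\beta$ in the binary expansion of $t$ is $1$. *)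

(* Defs.v *)
From HB Require Import structures.
From mathcomp Require Import all_boot all_order all_fingroup all_algebra.
Set Implicit Arguments.
Unset Strict Implicit.
Unset Printing Implicit Defensive.
Import GRing.Theory.
Local Open Scope ring_scope.

(* [k] is an integer, so that the type is empty for [k < 0] and for [k > n]. *)
Notation Omega n k := {A : {set 'I_n} | #|A|%:Z == k}.

Notation FOmega F n k := {ffun Omega n k -> F^o}.

Definition basisOmega (F : fieldType) (n : nat) (k : int) (Y : Omega n k) :
    FOmega F n k :=
  [ffun Z => (Z == Y)%:R].
Arguments basisOmega F {n k} Y.

Section Boundary.
Variables (F : fieldType) (n : nat) (j l : int).

Definition boundary_fun (v : FOmega F n j) : FOmega F n l :=
  \sum_(Y : Omega n j)
    v Y *: \sum_(X : Omega n l | val X \subset val Y) basisOmega F X.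

Fact boundary_fun_linear : linear boundary_fun.
Proof.
move=> a u v; rewrite /boundary_fun scaler_sumr -big_split.
by apply: eq_bigr => Y _; rewrite !ffunE scalerDl scalerA.
Qed.
HB.instance Definition _ :=
  GRing.isLinear.Build F (FOmega F n j) (FOmega F n l) *:%R boundary_fun
    boundary_fun_linear.

(* The multistep boundary map from [FOmega F n j] to [FOmega F n l].  It is
   indexed by source and target rather than by source and step [t = j - l],
   because [Omega n (k + t - t)] and [Omega n k] are not convertible types:
   phi^(t)_k is [boundary F n k (k - t)], and phi^(t)_(k+t) is
   [boundary F n (k + t) k]. *)
Definition boundary : 'Hom(FOmega F n j, FOmega F n l) := linfun boundary_fun.

Lemma boundary_basis (Y : Omega n j) :
  boundary (basisOmega F Y) =
  \sum_(X : Omega n l | val X \subset val Y) basisOmega F X.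
Proof.
rewrite lfunE /= /boundary_fun (bigD1 Y) //= ffunE eqxx scale1r.
by rewrite [X in _ + X]big1 ?addr0 // => Z ZY; rewrite ffunE (negbTE ZY) scale0r.
Qed.

End Boundary.

Section PermutationModule.
Variables (F : fieldType) (n : nat).
Implicit Types (k : int) (s : 'S_n).

Fact Omega_act_subproof k (Y : Omega n k) s : #|s @: val Y|%:Z == k.
Proof. by rewrite card_imset ?(valP Y) //; apply: perm_inj. Qed.

Definition Omega_act k s (Y : Omega n k) : Omega n k :=
  exist _ (s @: val Y) (Omega_act_subproof Y s).

Definition FOmega_act k s (v : FOmega F n k) : FOmega F n k :=
  \sum_(Y : Omega n k) v Y *: basisOmega F (Omega_act s Y).

Lemma Omega_actK k s : cancel (@Omega_act k s) (@Omega_act k s^-1%g).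
Proof.
move=> Y; apply: val_inj => /=; rewrite -imset_comp.
by rewrite (eq_imset _ (permK s)) imset_id.
Qed.

Fact FOmega_act_linear k s : linear (@FOmega_act k s).
Proof.
move=> a u v; rewrite /FOmega_act scaler_sumr -big_split.
by apply: eq_bigr => Y _; rewrite !ffunE scalerDl scalerA.
Qed.
HB.instance Definition _ k s :=
  GRing.isLinear.Build F (FOmega F n k) (FOmega F n k) *:%R
    (@FOmega_act k s) (@FOmega_act_linear k s).

Lemma FOmega_act_basis k s (Y : Omega n k) :
  FOmega_act s (basisOmega F Y) = basisOmega F (Omega_act s Y).
Proof.
rewrite /FOmega_act (bigD1 Y) //= ffunE eqxx scale1r.
by rewrite [X in _ + X]big1 ?addr0 // => Z ZY; rewrite ffunE (negbTE ZY) scale0r.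
Qed.

Lemma boundary_equivariant (j l : int) s (v : FOmega F n j) :
  boundary F n j l (FOmega_act s v) = FOmega_act s (boundary F n j l v).
Proof.
rewrite {1}/FOmega_act linear_sum [in RHS]lfunE /= /boundary_fun linear_sum.
apply: eq_bigr => Y _; rewrite !linearZ /= boundary_basis; congr (_ *: _).
rewrite linear_sum /= (reindex (@Omega_act l s)) /=; last first.
  exists (@Omega_act l s^-1%g) => X _; first exact: Omega_actK.
  by rewrite -{1}(invgK s) Omega_actK.
apply: eq_big => [X|X _]; last by rewrite FOmega_act_basis.
apply/idP/idP => [sXY|]; last exact: imsetS.
apply/subsetP => x xX; have := subsetP sXY _ (imset_f s xX).
by rewrite mem_imset //; apply: perm_inj.
Qed.

End PermutationModule.

Definition is_two_power (m : nat) : Prop := exists b : nat, m = (2 ^ b)%N.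

Definition in_binary_form (b t : nat) : bool := odd (t %/ 2 ^ b).

(* Main.v *)
(* Write D_t for the map of step t.  Since D_s D_t = 'C(s + t, s) D_(s + t),
   parities of binomial coefficients decide everything.  Transposing the maps
   and complementing sets exchanges k and n - k, so assume 2k <= n.

   Exactness for n >= 2k + t, when 'C(t, u) is even for 0 < u < t with u <= k:
   if n = 2k + t, then D_t U_t v = \sum_j 'C(t, j) U_(t - j) D_(t - j) v = v
   for v in the kernel, U denoting the maps to larger sets; for larger n, one
   deletes a point and uses induction on n.

   Failure: if k >= 2 ^ tau and t has a higher bit 2 ^ c, the image under
   D_(2 ^ c) of a (k + 2 ^ c)-set is a cycle; D_(2 ^ tau) does not kill it
   but kills the image of D_t.  If n < 2k + t and t > 1, then a suitable sum of
   transversals of k disjoint pairs is a cycle, and the sum of its coefficients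
   over the transversals of a second pairing, which vanishes on boundaries, is
   odd. *)
Require Import Defs.
From mathcomp Require Import all_boot all_order all_fingroup all_algebra.
From mathcomp Require Import zify.
Set Implicit Arguments.
Unset Strict Implicit.
Unset Printing Implicit Defensive.
Import GRing.Theory.
Local Open Scope ring_scope.

(** * Parity of binomial coefficients *)

Section Binomial.
Local Open Scope nat_scope.

(** In [t * 'C(t - 1, u - 1) = u * 'C(t, u)], an odd ['C(t, u)] is coprime to [2 ^ b], so [2 ^ b]
    would divide [u]. *)
Lemma even_bin_dvd2X b t u : 2 ^ b %| t -> ~~ (2 ^ b %| u) -> ~~ odd 'C(t, u).
Proof.
case: u => [|u]; first by rewrite dvdn0.
case: t => [|t]; first by rewrite bin0n.
move=> bt bu; apply: contra bu => oddC.
have := dvdn_trans bt (dvdn_mulr 'C(t, u) (dvdnn _)).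
rewrite mul_bin_diag Gauss_dvdl //.
by rewrite coprimeXl // prime_coprime // dvdn2 oddC.
Qed.

(** Lucas at a two-power: by Vandermonde, with all middle terms even, taking [2 ^ b] off [m] flips
    both parities. *)
Lemma odd_bin_2X m b : odd 'C(m, 2 ^ b) = odd (m %/ 2 ^ b).
Proof.
have b0 : 0 < 2 ^ b by rewrite expn_gt0.
elim/ltn_ind: m => m IHm.
case: (ltnP m (2 ^ b)) => [mb|bm]; first by rewrite bin_small // divn_small.
rewrite -{1 2}(subnK bm) divnDr // divnn b0 addn1 /= -IHm; last first.
  by rewrite ltn_subrL b0 (leq_trans b0 bm).
rewrite -binomial.Vandermonde.
rewrite -(big_mkord xpredT (fun i => 'C(m - 2 ^ b, i) * 'C(2 ^ b, 2 ^ b - i))).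
rewrite big_nat_recr //= big_ltn // subn0 subnn !bin0 binn !muln1.
rewrite !oddD /= -[RHS]addTb; congr (_ (+) _).
rewrite big_nat -dvdn2.
apply: (big_ind (fun x => 2 %| x)) => [||i /andP[i0 ib]] //.
  exact: dvdn_add.
rewrite dvdn_mull // dvdn2 (@even_bin_dvd2X b) //.
by apply/negP => /dvdn_leq; lia.
Qed.

End Binomial.

(** * Multistep maps on functions of sets *)

Section Down.
Variables (T : finType) (F : fieldType).
Implicit Types (A X Y Z W : {set T}) (v w : {set T} -> F) (s t k : nat).

(** The coefficient of D_t v at [X], inside the simplex on [A]; the ground set is a parameter so
    that points can be deleted. *)
Definition down A t v X : F :=
  \sum_(Y : {set T} | [&& X \subset Y, Y \subset A & #|Y| == (#|X| + t)%N]) v Y.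

(* A chain is a function on all sets of which only the values in the relevant
   degree matter.  Only ker <= im is demanded: the converse inclusion is
   automatic in characteristic 2 because 'C(2t, t) is even. *)
Definition exact_at A t k : Prop :=
  forall v,
    (forall X, X \subset A -> (#|X| + t)%N = k -> down A t v X = 0) ->
  exists w, forall X, X \subset A -> #|X| = k -> v X = down A t w X.

Lemma card_interval X Z m : X \subset Z ->
  #|[set Y : {set T} | [&& X \subset Y, Y \subset Z & #|Y| == (#|X| + m)%N]]|
  = 'C(#|Z| - #|X|, m).
Proof.
move=> XZ; have -> : (#|Z| - #|X|)%N = #|Z :\: X|.
  by rewrite cardsD (setIidPr XZ).
rewrite -cards_draws -[RHS](card_in_imset (f := fun W : {set T} => X :|: W)); last first.
  move=> W W'; rewrite !inE !subsetD => /andP[/andP[_ dW] _]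
    /andP[/andP[_ dW'] _].
  move=> /(congr1 (fun B => B :\: X)); rewrite !setDUl setDv !set0U.
  by move/setDidPl: dW => ->; move/setDidPl: dW' => ->.
apply: eq_card => Y; rewrite inE; apply/and3P/imsetP => [[XY YZ /eqP cY]|].
  exists (Y :\: X); last by rewrite -{1}(setID Y X) (setIidPr XY).
  by rewrite inE setSD // cardsD (setIidPr XY) cY addKn eqxx.
case=> W; rewrite inE subsetD => /andP[/andP[WZ dW] /eqP cW] ->.
rewrite subsetUl subUset XZ WZ cardsU cW; split=> //.
by rewrite setIC (disjoint_setI0 dW) cards0 subn0 eqxx.
Qed.

(** Each [Z] is reached once for every intermediate set between [X] and [Z]. *)
Lemma down_down A s t v X :
  down A s (down A t v) X = 'C(s + t, s)%:R * down A (s + t) v X.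
Proof.
rewrite /down (exchange_big_dep (fun Z => [&& X \subset Z, Z \subset A
  & #|Z| == #|X| + (s + t)]%N)) /=; last first.
  move=> Y Z /and3P[XY _ /eqP cY] /and3P[YZ -> /eqP ->].
  by rewrite (subset_trans XY YZ) cY addnA eqxx.
rewrite mulr_sumr; apply: eq_bigr => Z /and3P[XZ ZA /eqP cZ].
rewrite sumr_const mulr_natl; congr (_ *+ _).
have -> : (s + t = #|Z| - #|X|)%N by rewrite cZ addKn.
rewrite -(card_interval s XZ); apply: eq_card => Y; rewrite !inE.
rewrite unfold_in /= ZA /= cZ.
case: (X \subset Y) => //=; case YZ: (Y \subset Z); last by rewrite !andbF.
rewrite (subset_trans YZ ZA) /=.
case: eqP => //= ->; rewrite ?andbF //.
by rewrite addnA eqxx.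
Qed.

Lemma down0 A v X : X \subset A -> down A 0 v X = v X.
Proof.
move=> XA; rewrite /down (big_pred1 X) // => Y.
rewrite addn0 /=; apply/and3P/eqP => [[XY _ /eqP cY]|->]; last by [].
by apply/esym/eqP; rewrite eqEcard XY cY leqnn.
Qed.

Lemma eq_down A t v w X :
  (forall Y, Y \subset A -> #|Y| = (#|X| + t)%N -> v Y = w Y) ->
  down A t v X = down A t w X.
Proof. by move=> vw; apply: eq_bigr => Y /and3P[_ YA /eqP]; apply: vw. Qed.

End Down.

(** * Exactness in the boundary case #|A| = 2k + t *)

Section Exact.
Variables (T : finType) (F : fieldType).
Hypothesis F2 : 2%N \in [pchar F].
Implicit Types (A X Y Z W : {set T}) (v w : {set T} -> F) (s t k : nat).

Lemma natr_even m : ~~ odd m -> m%:R = 0 :> F.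
Proof. by move=> em; apply/eqP; rewrite -(dvdn_pcharf F2) dvdn2. Qed.

Lemma natr_odd m : odd m -> m%:R = 1 :> F.
Proof.
by case: m => // m /= /natr_even em; rewrite -natr1 em add0r.
Qed.

(* When #|A| = 2k + t, the coefficient 'C(#|A :\: (X :|: X')|, k) of X' in
   down (up v) X expands by Vandermonde, since
   #|A :\: (X :|: X')| = t + #|X :&: X'|. *)
Lemma down_up_middle A t k v X : #|A| = (2 * k + t)%N -> X \subset A ->
  #|X| = k ->
  down A t (fun Z => \sum_(Y : {set T} | (Y \subset Z) && (#|Y| == k)) v Y) X
  = \sum_(u < k.+1) 'C(t, u)%:R *
      \sum_(W : {set T} | (W \subset X) && (#|W| + u == k)%N) down A u v W.
Proof.
move=> cA XA cX; rewrite /down.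
rewrite (exchange_big_dep (fun Y : {set T} => (Y \subset A) && (#|Y| == k))) /=;
  last first.
  by move=> Z Y /and3P[_ ZA _] /andP[YZ ->]; rewrite (subset_trans YZ ZA).
under [RHS]eq_bigr => u _.
  rewrite (exchange_big_dep (fun Y : {set T} => (Y \subset A) && (#|Y| == k)))
    /=; last first.
    by move=> W Y /andP[_ /eqP cW] /and3P[_ -> /eqP->]; rewrite cW eqxx.
  rewrite mulr_sumr; over.
rewrite [RHS]exchange_big; apply: eq_bigr => Y /andP[YA /eqP cY] /=.
under [RHS]eq_bigr => u _ do rewrite sumr_const -[v Y *+ _]mulr_natl mulrA -natrM.
rewrite sumr_const -mulr_suml -natr_sum -[v Y *+ _]mulr_natl; congr (_%:R * _).
have cXY : (#|X :|: Y| + #|X :&: Y| = 2 * k)%N by rewrite cardsUI cX cY mul2n addnn.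
have XYA : X :|: Y \subset A by rewrite subUset XA.
have cD : (#|A :\: (X :|: Y)| = t + #|X :&: Y|)%N.
  by rewrite cardsD (setIidPr XYA) cA -cXY -addnA addKn addnC.
transitivity 'C(t + #|X :&: Y|, k).
  rewrite -cD -cards_draws -[RHS](card_in_imset (f := setD A)); last first.
    move=> W W'; rewrite !inE !subsetD => /andP[/andP[WA _] _].
    move=> /andP[/andP[WA' _] _] /(congr1 (setD A)).
    by rewrite !setDDr !setDv !set0U (setIidPr WA) (setIidPr WA').
  apply: eq_card => Z; rewrite unfold_in /=; apply/idP/imsetP.
    case/andP=> /and3P[XZ ZA /eqP cZ] /andP[YZ _]; exists (A :\: Z).
      rewrite inE setDS ?subUset ?XZ // cardsD (setIidPr ZA) cZ cA cX.
      by apply/eqP; lia.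
    by rewrite setDDr setDv set0U (setIidPr ZA).
  case=> W; rewrite inE subsetD => /andP[/andP[WA]].
  rewrite disjoints_subset setCU subsetI -!disjoints_subset.
  rewrite ![[disjoint W & _]]disjoint_sym => /andP[XW YW] /eqP cW ->.
  rewrite !subsetD XA YA subsetDl XW YW cardsD (setIidPr WA) cA cX cW cY eqxx.
  by rewrite /= andbT; apply/eqP; lia.
rewrite -binomial.Vandermonde; apply: eq_bigr => u _; congr (_ * _)%N.
rewrite -cards_draws; apply: eq_card => W; rewrite !inE unfold_in /= subsetI YA cY.
have uk : (u <= k)%N by rewrite -ltnS.
have -> : (#|W| == k - u)%N = (#|W| + u == k)%N by apply/eqP/eqP; lia.
by rewrite [k == _]eq_sym; case: (_ == k); rewrite ?andbF ?andbT.
Qed.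

Lemma exact_middle A t k : (0 < t)%N -> #|A| = (2 * k + t)%N ->
    (forall u, (0 < u < t)%N -> (u <= k)%N -> ~~ odd 'C(t, u)) ->
  exact_at F A t k.
Proof.
move=> t0 cA evC v Dv0.
(* The preimage is U_t v. In the expansion of D_t U_t v, [u = 0] gives [v X], [u = t] gives D_t v =
   0, and the other terms vanish by parity or because [u > t]. *)
exists (fun Z => \sum_(Y : {set T} | (Y \subset Z) && (#|Y| == k)) v Y).
move=> X XA cX; rewrite (down_up_middle v cA XA cX) big_ord_recl [X in _ + X]big1 => [|u _].
  rewrite bin0 mul1r addr0 (big_pred1 X) => [|W].
    exact/esym/down0.
  rewrite addn0 /=; apply/andP/eqP => [[WX /eqP cW]|->]; last by rewrite cX.
  by apply/eqP; rewrite eqEcard WX cW cX leqnn.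
rewrite lift0.
case: (ltngtP u.+1 t) => [ut|tu|ut].
- by rewrite natr_even ?mul0r // evC.
- by rewrite bin_small ?mul0r.
rewrite big1 ?mulr0 // => W /andP[WX /eqP cW].
by rewrite ut Dv0 ?(subset_trans WX XA) // -ut.
Qed.

End Exact.

(** * Deleting a point, and exactness for large ground sets *)

Section DeletePoint.
Variables (T : finType) (F : fieldType).
Hypothesis F2 : 2%N \in [pchar F].
Implicit Types (A X Y Z W : {set T}) (v w : {set T} -> F) (s t k : nat).

Lemma downD A t v w X :
  down A t (fun Y => v Y + w Y) X = down A t v X + down A t w X.
Proof. exact: big_split. Qed.

Lemma down_setU1 A a t v X : a \in A -> a \notin X ->
  down A t v (a |: X) = down (A :\ a) t (fun Y => v (a |: Y)) X.
Proof.
move=> aA aX.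
rewrite /down (reindex_onto (fun Y => a |: Y) (fun Y => Y :\ a)) /=; last first.
  by move=> Y /and3P[/subUsetP[/[1!sub1set] aY _] _ _]; rewrite setD1K.
apply: eq_bigl => Y; rewrite subsetD1 subUset !cardsU1 aX sub1set setU11.
rewrite subUset sub1set aA /=.
have [aY|aY] := boolP (a \in Y); rewrite /= ?andbF ?andbT.
  by apply/negbTE/nandP; right; apply: contraL aY => /eqP <-; rewrite setD11.
rewrite setU1K // eqxx andbT -addnA eqn_add2l; congr (_ && _).
apply/subsetP/subsetP => XY x xX; last by rewrite inE XY // orbT.
by have := XY x xX; rewrite !inE => /predU1P[xa|//]; rewrite -xa xX in aX.
Qed.

(** The supersets of [X] avoiding [a] give the first term; those through [a], with [a] removed, are
    only [t] larger than [X]. *)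
Lemma downS A a t v X : a \in A -> a \notin X ->
  down A t.+1 v X =
  down (A :\ a) t.+1 v X + down (A :\ a) t (fun Y => v (a |: Y)) X.
Proof.
move=> aA aX; rewrite -down_setU1 // /down (bigID (fun Y => a \in Y)) addrC /=.
congr (_ + _); apply: eq_bigl => Y; last first.
  by rewrite subsetD1; case: (a \in Y); rewrite ?andbF ?andbT.
rewrite subUset sub1set cardsU1 aX addSnnS /=.
by rewrite andbC -!andbA addnS.
Qed.

(* The full simplex is a cone with apex a. *)
Lemma exact_at1 A k : A != set0 -> exact_at F A 1 k.
Proof.
case/set0Pn=> a aA v Dv0.
exists (fun Z => if a \in Z then v (Z :\ a) else 0) => X XA cX.
have [aX|aX] := boolP (a \in X); last first.
  rewrite (downS _ _ aA aX) down0 ?subsetD1 ?XA //= setU11 setU1K // -[LHS]add0r.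
  congr (_ + _); rewrite /down big1 // => Y.
  by rewrite subsetD1 => /and3P[_ /andP[_ /negbTE ->]].
have XA' := subset_trans (subsetDl X [set a]) XA.
have cX' : (#|X :\ a| + 1)%N = k by rewrite -cX (cardsD1 a X) aX addnC.
have := Dv0 _ XA' cX'; rewrite (downS _ _ aA) ?setD11 // down0 ?setSD // setD1K //.
move/eqP; rewrite addr_eq0 oppr_pchar2 // => /eqP <-.
rewrite -[in RHS](setD1K aX) down_setU1 ?setD11 //; apply: eq_down => Y.
by rewrite subsetD1 => /andP[_ aY] _; rewrite setU11 setU1K.
Qed.

Lemma exact_at_large A t k : (0 < t)%N -> (2 * k + t <= #|A|)%N ->
    (forall u, (0 < u < t)%N -> (u <= k)%N -> ~~ odd 'C(t, u)) ->
  exact_at F A t k.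
Proof.
move=> t0; have [m] := ubnP #|A|; elim: m A k => // m IHm A k Am kA evC.
case: (ltngtP (2 * k + t) #|A|) kA => // [kA _|kA _]; last exact: exact_middle.
have /card_gt0P[a aA] : (0 < #|A|)%N by apply: leq_ltn_trans kA.
(* From here on the step is [t.+1]. *)
case: t t0 IHm kA evC => // t _ IHm kA evC v Dv0.
pose A' := A :\ a.
have cA : #|A| = #|A'|.+1 by rewrite (cardsD1 a) aA.
(* The part of [v] through [a] is a cycle in degree k - 1 on [A'], bounded by [w1]. Then [v] plus
   D_t w1 is a cycle on [A'], bounded by [w0]. *)
have [w1 w1P] : exists w1, forall X, X \subset A' -> #|X|.+1 = k ->
    v (a |: X) = down A' t.+1 w1 X.
  case: k kA evC Dv0 => [|k] kA evC Dv0; first by exists (fun=> 0).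
  have [|||X|w1 w1P] := IHm A' k _ _ _ (fun X => v (a |: X)).
  - by rewrite -ltnS -cA (leq_trans Am).
  - by lia.
  - by move=> u ut uk; apply: evC => //; apply: leqW.
  - rewrite subsetD1 => /andP[XA aX] cX; rewrite -down_setU1 //.
    by rewrite Dv0 ?subUset ?sub1set ?aA // cardsU1 aX -cX.
  by exists w1 => X XA' [cX]; apply: w1P.
have [||//|X XA' cX|w0 w0P] :=
    IHm A' k _ _ _ (fun X => v X + down A' t w1 X).
- by rewrite -ltnS -cA (leq_trans Am).
- by lia.
- rewrite downD down_down.
  move: (XA'); rewrite subsetD1 => /andP[XA aX].
  have := downS t v aA aX; rewrite Dv0 //.
  rewrite [X in _ + X](@eq_down _ _ _ _ _ (down A' t.+1 w1)); last first.
    by move=> Y YA' cY; apply: w1P; rewrite // cY -cX addnS.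
  (* Symmetry of binomials makes D_t D_(t+1) and D_(t+1) D_t the same multiple of D_(2t+1). *)
  rewrite down_down -['C(t + _, t)]bin_sub ?leq_addr // addKn.
  by rewrite [(t + _)%N]addnC => <-.
exists (fun Z => if a \in Z then w1 (Z :\ a) else w0 Z) => X XA cX.
have [aX|aX] := boolP (a \in X).
  rewrite -(setD1K aX) down_setU1 ?setD11 //.
  rewrite w1P ?setSD //; last by rewrite -cX [in RHS](cardsD1 a) aX.
  apply: eq_down => Y; rewrite subsetD1 => /andP[_ aY] _.
  by rewrite setU11 setU1K.
rewrite (downS _ _ aA aX) (@eq_down _ _ _ _ _ w0) => [|Y]; last first.
  by rewrite subsetD1 => /andP[_ /negbTE ->].
rewrite [X in _ + X](@eq_down _ _ _ _ _ w1) => [|Y]; last first.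
  by rewrite subsetD1 => /andP[_ aY] _; rewrite setU11 setU1K.
by rewrite -w0P ?subsetD1 ?XA // -addrA addrr_pchar2 ?addr0.
Qed.

End DeletePoint.

(** * Failure of exactness *)

Section NonExact.
Variables (T : finType) (F : fieldType).
Hypothesis F2 : 2%N \in [pchar F].
Implicit Types (A X Y Z S C : {set T}) (v w : {set T} -> F) (s t k : nat).

(* The image of a (k + 2 ^ c)-set is in the kernel, but applying the step 2 ^ b,
   which kills the image, does not kill it. *)
Lemma not_exact_at_bits A k t b c : (b < c)%N ->
    odd (t %/ 2 ^ b) -> odd (t %/ 2 ^ c) -> (2 ^ b <= k)%N ->
    (k + 2 ^ c <= #|A|)%N ->
  ~ exact_at F A t k.
Proof.
move=> bc tb tc bk kA ex.
(* Adding [2 ^ d] to a number whose bit [d] is set clears that bit. *)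
have carry d : odd (t %/ 2 ^ d) -> 'C(t + 2 ^ d, 2 ^ d)%:R = 0 :> F.
  move=> td; rewrite natr_even // odd_bin_2X divnDr ?dvdnn // divnn expn_gt0 /=.
  by rewrite addn1 /= td.
have [Y YA cY] : exists2 Y : {set T}, Y \subset A & #|Y| = (k + 2 ^ c)%N.
  have : (0 < #|[set Y : {set T} | Y \subset A & #|Y| == (k + 2 ^ c)%N]|)%N.
    by rewrite cards_draws bin_gt0.
  by case/card_gt0P=> Y; rewrite inE => /andP[YA /eqP]; exists Y.
have [|w wP] := ex (down A (2 ^ c) (fun Z => (Z == Y)%:R : F)).
  by move=> X _ _; rewrite down_down -bin_sub ?leq_addr // addKn carry ?mul0r.
(* [X] is chosen so that #|Y| - #|X| is [2 ^ b + 2 ^ c]: the coefficient at [X] is then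
   ['C(2 ^ b + 2 ^ c, 2 ^ b)], odd since [b < c]. *)
have [X XY cX] : exists2 X : {set T}, X \subset Y & #|X| = (k - 2 ^ b)%N.
  have : (0 < #|[set X : {set T} | X \subset Y & #|X| == (k - 2 ^ b)%N]|)%N.
    by rewrite cards_draws bin_gt0 cY; lia.
  by case/card_gt0P=> X; rewrite inE => /andP[XA /eqP]; exists X.
have : down A (2 ^ b) (down A (2 ^ c) (fun Z => (Z == Y)%:R : F)) X = 0.
  rewrite (@eq_down _ _ _ _ _ (down A t w)); last first.
    by move=> Z ZA cZ; rewrite wP // cZ cX subnK.
  by rewrite down_down [(2 ^ b + t)%N]addnC carry ?mul0r.
rewrite down_down (natr_odd F2) ?mul1r; last first.
  rewrite odd_bin_2X -(subnK (ltnW bc)) expnD -[X in (X + _)%N]mul1n -mulnDl.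
  by rewrite mulnK ?expn_gt0 // add1n /= oddX subn_eq0 leqNgt bc.
rewrite /down (bigD1 Y) /=; last by rewrite XY YA cX cY; apply/eqP; lia.
rewrite eqxx big1 => [|Z /andP[_ /negbTE ->] //].
by move/eqP; rewrite addr0 oner_eq0.
Qed.

Section Transversal.
Variables (k : nat) (a b : 'I_k -> T).
Hypotheses (a_inj : injective a) (b_inj : injective b).
Hypothesis ab_neq : forall i j, a i != b j.

(** Points outside the pairs are unconstrained; the condition [#|S| == k], imposed separately,
    excludes them. *)
Definition transversal_of S := [forall i, (a i \in S) != (b i \in S)].

Let swap i S := tperm (a i) (b i) @: S.

Lemma in_swap i S x : (x \in swap i S) = (tperm (a i) (b i) x \in S).
Proof.
rewrite /swap -{1}(tpermK (a i) (b i) x) mem_imset //; exact: perm_inj.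
Qed.

Lemma transversal_swap i S : transversal_of (swap i S) = transversal_of S.
Proof.
apply: eq_forallb => j; rewrite !in_swap.
have [<-|ij] := eqVneq i j; first by rewrite tpermL tpermR eq_sym.
have baE i1 j1 : b i1 != a j1 by rewrite eq_sym.
by rewrite !tpermD ?ab_neq ?baE ?(inj_eq a_inj) ?(inj_eq b_inj).
Qed.

Lemma swap_id i C : (a i \in C) = (b i \in C) -> swap i C = C.
Proof. by move=> ab; apply/setP=> x; rewrite in_swap; case: tpermP => [->|->|]. Qed.

Lemma subset_swap i S S' : (swap i S \subset swap i S') = (S \subset S').
Proof.
apply/idP/idP; last exact: imsetS.
move/subsetP=> SS'; apply/subsetP=> x xS.
have := SS' (tperm (a i) (b i) x); rewrite !in_swap tpermK; exact.
Qed.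

(** If [C] met every pair, choosing a point of [C] in each would inject ['I_k] into [C]. *)
Lemma ex_pair_disjoint C : (#|C| < k)%N ->
  exists i, (a i \notin C) && (b i \notin C).
Proof.
move=> Ck; apply/existsP; apply: contraLR Ck => /existsPn noi.
pose g i := if a i \in C then a i else b i.
have g_inj : injective g.
  move=> i j; rewrite /g; case: ifP => _; case: ifP => _ E.
  - exact: a_inj.
  - by have := ab_neq i j; rewrite E eqxx.
  - by have := ab_neq j i; rewrite E eqxx.
  - exact: b_inj.
rewrite -leqNgt -{1}(card_ord k) -(card_codom g_inj); apply/subset_leq_card.
apply/subsetP=> _ /codomP[i ->]; rewrite /g.
by have := noi i; rewrite negb_and !negbK; case: ifP.
Qed.

(* Swapping a pair that avoids C is a fixed-point-free involution. *)
Lemma sum_transversal_even C (P : pred {set T}) : (#|C| < k)%N ->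
    (forall i S, a i \notin C -> b i \notin C -> P (swap i S) = P S) ->
  \sum_(S : {set T} | [&& P S, #|S| == k & transversal_of S]) 1 = 0 :> F.
Proof.
move=> /ex_pair_disjoint[i /andP[aC bC]] Pswap.
rewrite (bigID (fun S => a i \in S)) /= [X in _ + X](reindex_inj (h := swap i)) /=;
  last by apply: imset_inj; exact: perm_inj.
rewrite [X in _ + X](eq_bigl (fun S =>
  [&& P S, #|S| == k & transversal_of S] && (a i \in S))) => [|S].
  exact: addrr_pchar2.
rewrite Pswap // transversal_swap in_swap tpermL card_imset; last exact: perm_inj.
case: (P S) => //; case: (_ == k) => //=.
case tS: (transversal_of S) => //=; move/forallP: tS => /(_ i).
by case: (a i \in S); case: (b i \in S).
Qed.

End Transversal.

(* The pairs {a i, b i} and {a i, b (i + 1)} form a 2k-cycle, so the two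
   pairings have exactly two common transversals, of which only one contains a
   given point. *)
Lemma common_transversal k (a b : 'I_k.+1 -> T) S : injective a ->
    transversal_of a b S -> transversal_of a (b \o @ordS k.+1) S ->
    a ord_max \in S -> #|S| = k.+1 ->
  S = a @: setT.
Proof.
move=> a_inj /forallP tS /forallP tS' aS cS; apply/eqP.
rewrite eq_sym eqEcard card_imset // cardsT card_ord cS leqnn andbT.
suff aiS m : forall i : 'I_k.+1, (i + m = k)%N -> a i \in S.
  apply/subsetP=> _ /imsetP[i _ ->]; apply: (aiS (k - i)%N).
  by rewrite subnKC // -ltnS.
elim: m => [|m IHm] i im.
  by have -> : i = ord_max by apply: val_inj => /=; lia.
have iS : ordS i = i.+1 :> nat by rewrite /= modn_small //; lia.
have aiS : a (ordS i) \in S by apply: IHm; rewrite iS; lia.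
have : (a i \in S) != (b (ordS i) \in S) := tS' i.
have := tS (ordS i); rewrite aiS.
by case: (a i \in S) => //; case: (b _ \in S).
Qed.

Lemma not_exact_at_narrow t k : (1 < t)%N -> (2 * k <= #|T|)%N ->
  (#|T| < 2 * k + t)%N -> ~ exact_at F [set: T] t k.
Proof.
move=> t1; case: k => [|k] kT Tkt ex.
  (* In degree 0 the constant 1 is a cycle, and there are too few points for any [t]-set to bound
     it. *)
  have [|w wP] := ex (fun=> 1) => [X _|]; first by lia.
  have := wP set0 (sub0set _) (cards0 T); rewrite /down big_pred0 => [/eqP|Y].
    by rewrite oner_eq0.
  have := max_card Y; rewrite cards0; lia.
rewrite mul2n -addnn in kT.
pose h i : T := enum_val (widen_ord kT i).
have h_inj : injective h by move=> i j /enum_val_inj /(congr1 val) /= /val_inj.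
(* The first 2(k + 1) points are cut into halves [a] and [b]; [b'] below shifts [b] cyclically to
   give the second pairing. *)
pose a i := h (lshift k.+1 i); pose b i := h (rshift k.+1 i).
have a_inj : injective a by move=> i j /h_inj /lshift_inj.
have b_inj : injective b by move=> i j /h_inj /rshift_inj.
have ab_neq i j : a i != b j by rewrite (inj_eq h_inj) eq_lrshift.
pose b' := b \o @ordS k.+1.
have b'_inj : injective b' by apply: inj_comp => //; apply: ordS_inj.
have ab'_neq i j : a i != b' j by apply: ab_neq.
have [X _ cX|w wP] :=
  ex (fun S => (transversal_of a b S && (a ord_max \in S))%:R).
  (* As [t > 1], adding [a ord_max] to [X] still leaves a pair untouched. *)
  have Ck : (#|a ord_max |: X| < k.+1)%N.
    by rewrite cardsU1; case: (_ \notin X); lia.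
  rewrite -[RHS](sum_transversal_even a_inj b_inj ab_neq Ck
    (P := fun S => a ord_max |: X \subset S)); last first.
    move=> i S aC bC; rewrite -{1}(@swap_id _ a b i (_ |: _)) ?subset_swap //.
    by rewrite (negbTE aC) (negbTE bC).
  rewrite /down big_mkcond [RHS]big_mkcond; apply: eq_bigr => S _.
  rewrite subsetT cX subUset sub1set /=.
  by case: (X \subset S); case: (_ == k.+1); case: (a _ \in S) => //=;
    case: (transversal_of _ _ _).
pose f S : F := (transversal_of a b' S)%:R.
(* The functional [f] kills boundaries: the complement of a [(k.+1 + t)]-set [Z] has fewer than
   [k.+1] points, so [Z] contains a whole pair to swap. *)
have : \sum_(S : {set T} | #|S| == k.+1) f S * down [set: T] t w S = 0.
  rewrite /down; under eq_bigr do rewrite mulr_sumr.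
  rewrite (exchange_big_dep (fun Z => #|Z| == (k.+1 + t)%N)) /=; last first.
    by move=> S Z /eqP -> /and3P[].
  rewrite big1 // => Z /eqP cZ; rewrite -mulr_suml.
  have Ck : (#|~: Z| < k.+1)%N by have := cardsC Z; lia.
  have even := sum_transversal_even a_inj b'_inj ab'_neq Ck
    (P := fun S => S \subset Z).
  rewrite [X in X * _](_ : _ = 0) ?mul0r // -[RHS]even; last first.
    move=> i S; rewrite !inE !negbK => aZ bZ.
    by rewrite -{1}(@swap_id _ a b' i Z) ?subset_swap // aZ bZ.
  rewrite big_mkcond [RHS]big_mkcond; apply: eq_bigr => S _.
  rewrite subsetT /f; case: eqP => [->|_]; rewrite ?andbF //= cZ eqxx andbT.
  by case: (S \subset Z) => //; case: (transversal_of _ _ _).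
under eq_bigr => S /eqP cS do rewrite -wP ?subsetT //.
(* On the chosen cycle only the common transversal [a @: setT] contributes, so [f] takes the value 1
   there. *)
rewrite (bigD1 (a @: setT)) /=; last by rewrite card_imset // cardsT card_ord.
rewrite [X in _ + X]big1 ?addr0 => [|S /andP[/eqP cS nS]]; last first.
  rewrite /f; case tS': (transversal_of a b' S); rewrite ?mul0r // mul1r.
  case: andP => // -[tS aS].
  by rewrite (common_transversal a_inj tS tS' aS cS) eqxx in nS.
have ain i : a i \in a @: setT by rewrite imset_f.
have bnotin i : b i \notin a @: setT.
  by apply/imsetP => -[j _ /esym/eqP]; apply/negP.
rewrite /f ain andbT.
have -> : transversal_of a b' (a @: setT).
  by apply/forallP=> i; rewrite ain (negbTE (bnotin _)).
have -> : transversal_of a b (a @: setT).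
  by apply/forallP=> i; rewrite ain (negbTE (bnotin _)).
by move/eqP; rewrite mul1r oner_eq0.
Qed.

End NonExact.

(** * Transposition and complementation *)

Section Duality.
Variable F : fieldType.

(** The transposed cokernel of [B^T] lies in the kernel of [B], hence factors through [A]; so
    [v *m A^T = 0] forces [v] to vanish on the cokernel. *)
Lemma kermx_sub_dual (m n p : nat) (A : 'M[F]_(m, n)) (B : 'M_(n, p))
    (v : 'rV_n) :
  (kermx B <= A)%MS -> v *m A^T = 0 -> (v <= B^T)%MS.
Proof.
move=> kBA vA; rewrite submxE.
have /submx_trans/(_ kBA) : ((cokermx B^T)^T <= kermx B)%MS.
  by apply/sub_kermxP/trmx_inj; rewrite trmx_mul trmxK mulmx_coker trmx0.
by case/submxP=> D /(congr1 trmx); rewrite trmxK => ->; rewrite trmx_mul mulmxA vA mul0mx.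
Qed.

Lemma exact_transpose (I J K : finType) (P : pred J)
    (a : I -> J -> F) (b : J -> K -> F) :
    (forall v : J -> F, (forall k, \sum_(j | P j) v j * b j k = 0) ->
       exists w, forall j, P j -> v j = \sum_i w i * a i j) ->
  forall v : J -> F, (forall i, \sum_(j | P j) a i j * v j = 0) ->
     exists w, forall j, P j -> v j = \sum_k b j k * w k.
Proof.
move=> ex v av.
pose A := \matrix_(i < #|I|, j < #|P|) a (enum_val i) (enum_val j).
pose B := \matrix_(j < #|P|, k < #|K|) b (enum_val j) (enum_val k).
have kBA : (kermx B <= A)%MS.
  apply/row_subP=> r; set u := row r _.
  have uB : u *m B = 0 by apply/sub_kermxP/row_sub.
  (* Extension by zero of a row indexed by [P] to all of [J]. *)
  pose u' (j : J) := \sum_i (if enum_val i == j then u 0 i else 0).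
  have u'E i : u' (enum_val i) = u 0 i.
    rewrite /u' (bigD1 i) //= eqxx big1 ?addr0 // => i' ii'.
    by rewrite (inj_eq enum_val_inj) (negbTE ii').
  have [k|w wP] := ex u'.
    rewrite big_enum_val /=; have /rowP/(_ (enum_rank k)) := uB.
    rewrite !mxE => uB0; rewrite -[RHS]uB0; apply: eq_bigr => j _.
    by rewrite u'E !mxE enum_rankK.
  apply/submxP; exists (\row_i w (enum_val i)); apply/rowP=> j.
  rewrite -u'E wP; last exact: (enum_valP j).
  rewrite mxE (reindex _ (onW_bij _ (@enum_val_bij I))) /=.
  by apply: eq_bigr => i _; rewrite !mxE.
have : (\row_j v (enum_val j) <= B^T)%MS.
  apply: kermx_sub_dual kBA _; apply/rowP=> i; rewrite !mxE.
  rewrite -[RHS](av (enum_val i)) [RHS]big_enum_val; apply: eq_bigr => j _.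
  by rewrite !mxE mulrC.
case/submxP=> w wP; exists (fun k => w 0 (enum_rank k)) => j Pj.
have := congr1 (fun M : 'rV_ _ => M 0 (enum_rank_in Pj j)) wP.
rewrite !mxE enum_rankK_in // => ->; rewrite [RHS](reindex _ (onW_bij _ (@enum_val_bij K))) /=.
by apply: eq_bigr => k _; rewrite !mxE enum_rankK_in // enum_valK mulrC.
Qed.

(** Transposing turns the maps to smaller sets into maps to larger sets; complementation turns them
    back and sends degree k to #|T| - k. *)
Lemma exact_at_compl (T : finType) t k : (k <= #|T|)%N ->
  exact_at F [set: T] t k -> exact_at F [set: T] t (#|T| - k).
Proof.
move=> kT ex v Dv.
have cC (X : {set T}) : (#|X| + #|~: X|)%N = #|T| by apply: cardsC.
have [] := @exact_transpose _ _ _ (fun X : {set T} => #|X| == k)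
  (fun Z X : {set T} => ((X \subset Z) && (#|Z| == k + t)%N)%:R)
  (fun X W : {set T} => ((W \subset X) && (#|W| + t == k)%N)%:R) _
  (fun X => v (~: X)).
- move=> u uD; have [X _ cX|w wP] := ex u.
    rewrite -[RHS](uD X) cX eqxx /down big_mkcond [RHS]big_mkcond /=.
    apply: eq_bigr => Y _; rewrite subsetT cX.
    by case: (X \subset Y); case: (#|Y| == k); rewrite ?(mulr1, mulr0).
  exists w => X /eqP cX; rewrite wP ?subsetT // /down big_mkcond /=.
  apply: eq_bigr => Y _; rewrite subsetT cX.
  by case: (_ && _); rewrite ?(mulr1, mulr0).
- move=> Z; have [cZ|cZ] := eqVneq #|Z| (k + t)%N; last first.
    by rewrite big1 // => X _; rewrite andbF mul0r.
  have cZ' : (#|~: Z| + t)%N = (#|T| - k)%N by have := cC Z; lia.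
  rewrite -[RHS](Dv (~: Z)) ?subsetT // /down [RHS](reindex_inj (@setC_inj T)) /=.
  rewrite big_mkcond [RHS]big_mkcond /=; apply: eq_bigr => X _.
  rewrite subsetT setCS andbT cZ'.
  have -> : (#|~: X| == #|T| - k)%N = (#|X| == k).
    by have := cC X; have := max_card X; lia.
  by case: (X \subset Z); case: (#|X| == k); rewrite ?(mul1r, mul0r).
move=> w wP; exists (fun Y => w (~: Y)) => X _ cX.
rewrite -[X in v X]setCK wP; last by apply/eqP; have := cC X; lia.
rewrite /down [RHS](reindex_inj (@setC_inj T)) /= [RHS]big_mkcond /=.
apply: eq_bigr => W _; rewrite setCK subsetT cX.
rewrite -{2}(setCK X) setCS.
have -> : (#|~: W| == #|T| - k + t)%N = (#|W| + t == k)%N.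
  by have := cC W; have := max_card W; lia.
by case: (W \subset _); case: (_ == k); rewrite ?(mul1r, mul0r).
Qed.

End Duality.

(** By Pascal it is a sum of two equal terms. This gives D_t D_t = 0 in characteristic 2. *)
Lemma even_central_bin t : ~~ odd 'C(t.+1 + t.+1, t.+1).
Proof.
rewrite addnS binS oddD -['C(_, t)]bin_sub ?leqW ?leq_addl //.
by rewrite addSn subSn ?leq_addl // addnK addbb.
Qed.

(** * Translation between [boundary] and [down] *)

Section Boundary.
Variables (F : fieldType) (n : nat).

Lemma sum_Omega (j : int) (P : pred {set 'I_n}) (f : {set 'I_n} -> F) :
  \sum_(Y : Omega n j | P (val Y)) f (val Y) =
  \sum_(S : {set 'I_n} | (#|S|%:Z == j) && P S) f S.
Proof.
exact: esym (big_sub_cond [pred S : {set 'I_n} | #|S|%:Z == j] P f).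
Qed.

Lemma boundaryE (j l : int) (v : FOmega F n j) (X : Omega n l) :
  boundary F n j l v X = \sum_(Y : Omega n j | val X \subset val Y) v Y.
Proof.
rewrite lfunE /= /boundary_fun sum_ffunE [RHS]big_mkcond /=.
apply: eq_bigr => Y _; rewrite ffunE sum_ffunE.
case: ifP => XY.
  rewrite (bigD1 X) //= big1 => [|Z /andP[_ ZX]]; rewrite ffunE.
    by rewrite eqxx addr0 /GRing.scale /= mulr1.
  by rewrite eq_sym (negbTE ZX).
rewrite big1 ?scaler0 // => Z ZY; rewrite ffunE.
by case: eqP => // XZ; rewrite XZ ZY in XY.
Qed.

Definition of_set_fun (j : int) (f : {set 'I_n} -> F) : FOmega F n j :=
  [ffun Y => f (val Y)].

Definition to_set_fun (j : int) (v : FOmega F n j) (S : {set 'I_n}) : F :=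
  if insub S is Some Y then v Y else 0.

Lemma to_set_funE j (v : FOmega F n j) Y : to_set_fun v (val Y) = v Y.
Proof. by rewrite /to_set_fun valK. Qed.

Lemma to_set_funK j : cancel (@to_set_fun j) (@of_set_fun j).
Proof. by move=> v; apply/ffunP=> Y; rewrite ffunE to_set_funE. Qed.

Lemma boundary_down (j l : int) t f (X : Omega n l) : j = l + t%:Z ->
  boundary F n j l (of_set_fun j f) X = down [set: 'I_n] t f (val X).
Proof.
move=> jl; rewrite boundaryE; under eq_bigr do rewrite ffunE.
rewrite (sum_Omega j (fun S => val X \subset S)) /down; apply: eq_bigl => S.
rewrite subsetT andbC jl /=; congr (_ && _).
by case: X => X /= /eqP <-; rewrite -PoszD.
Qed.

(** For [k < t] the target [Omega] is empty and no [X] has [#|X| + t = k], so the kernel conditions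
    agree there too. *)
Lemma boundary_exactP t k : 2%N \in [pchar F] -> (0 < t)%N ->
  lker (boundary F n k%:Z (k%:Z - t%:Z)) = limg (boundary F n (k%:Z + t%:Z) k%:Z)
  <-> exact_at F [set: 'I_n] t k.
Proof.
move=> F2 t0; have kt : k%:Z = k%:Z - t%:Z + t%:Z by rewrite subrK.
split=> [kerim v Dv|ex].
  have : of_set_fun k%:Z v \in lker (boundary F n k%:Z (k%:Z - t%:Z)).
    rewrite memv_ker; apply/eqP/ffunP=> X; rewrite (boundary_down _ _ kt) ffunE.
    apply: Dv (subsetT _) _; have /eqP := valP X => /=; lia.
  rewrite kerim => /memv_imgP[w _ wP]; exists (to_set_fun w) => X _ /eqP cX.
  have cX' : #|X|%:Z == k%:Z by [].
  have := congr1 (fun u : FOmega F n k => u (Sub X cX')) wP.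
  by rewrite -{1}(to_set_funK w) (boundary_down _ _ erefl) ffunE.
apply/vspaceP=> v; rewrite memv_ker; apply/eqP/memv_imgP.
  move=> Dv.
  have [X _ cX|w wP] := ex (to_set_fun v).
    have cX' : #|X|%:Z == k%:Z - t%:Z by lia.
    have := congr1 (fun u : FOmega F n _ => u (Sub X cX')) Dv.
    by rewrite -{1}(to_set_funK v) (boundary_down _ _ kt) ffunE.
  exists (of_set_fun _ w); first exact: memvf.
  apply/ffunP=> X; rewrite (boundary_down _ _ erefl) -wP ?subsetT ?to_set_funE //.
  by have /eqP := valP X => -[].
(* The inclusion im <= ker, from D_t D_t = 0. *)
case=> w _ ->; rewrite -(to_set_funK w); set f := to_set_fun w.
have -> : boundary F n (k%:Z + t%:Z) k%:Z (of_set_fun _ f) =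
    of_set_fun _ (down [set: 'I_n] t f).
  by apply/ffunP=> X; rewrite (boundary_down _ _ erefl) ffunE.
apply/ffunP=> X; rewrite (boundary_down _ _ kt) down_down ffunE natr_even ?mul0r //.
by rewrite -(prednK t0) even_central_bin.
Qed.

End Boundary.

(** * The least and the highest bit of t *)

Section LeastBit.
Local Open Scope nat_scope.
Variables t tau : nat.
Hypothesis t_gt0 : 0 < t.
Hypothesis tau_bit : in_binary_form tau t.
Hypothesis tau_least : forall b, in_binary_form b t -> 2 ^ tau <= 2 ^ b.

Lemma least_bit_dvdn : 2 ^ tau %| t.
Proof.
suff dvd b : b <= tau -> 2 ^ b %| t by apply: dvd.
elim: b => // b IHb b_tau; have bt := IHb (ltnW b_tau).
rewrite expnS -(divnK bt) dvdn_pmul2r ?expn_gt0 // dvdn2.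
by apply: contraL b_tau => /tau_least; rewrite leq_exp2l // -leqNgt.
Qed.

Lemma two_power_least_bit : is_two_power t -> t = 2 ^ tau.
Proof.
case=> b tb; apply/eqP; rewrite eqn_leq andbC dvdn_leq ?least_bit_dvdn //= tb.
rewrite leq_exp2l // leqNgt; apply: contraL tau_bit => tau_b.
rewrite /in_binary_form tb -(subnK (ltnW tau_b)) expnD mulnK ?expn_gt0 //.
by rewrite oddX subn_eq0 leqNgt tau_b.
Qed.

(** Take for [c] the highest bit; if it coincides with [tau], then [t = 2 ^ tau]. *)
Lemma two_power_or_higher_bit : is_two_power t \/
  exists c, [/\ tau < c, 2 ^ c <= t & in_binary_form c t].
Proof.
have ct : 2 ^ trunc_log 2 t <= t by apply: trunc_logP.
have tc : t < 2 ^ (trunc_log 2 t).+1 by apply: trunc_log_ltn.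
have bitc : t %/ 2 ^ trunc_log 2 t = 1.
  apply/eqP; rewrite eqn_leq divn_gt0 ?expn_gt0 // ct andbT -ltnS.
  by rewrite ltn_divLR ?expn_gt0 // -expnS.
have oddc : in_binary_form (trunc_log 2 t) t by rewrite /in_binary_form bitc.
have := tau_least oddc; rewrite leq_exp2l // leq_eqVlt.
case/predU1P=> [tauE|tau_c]; [left | by right; exists (trunc_log 2 t)].
by exists tau; rewrite -(divnK least_bit_dvdn) {1}tauE bitc mul1n.
Qed.

End LeastBit.

(** * The criterion for 2k <= n, and the general case *)

Lemma exact_at_lower_half (F : fieldType) (T : finType) t k tau :
    2%N \in [pchar F] -> (0 < t)%N -> (0 < #|T|)%N -> in_binary_form tau t ->
    (forall b, in_binary_form b t -> (2 ^ tau <= 2 ^ b)%N) ->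
    (2 * k <= #|T|)%N ->
  exact_at F [set: T] t k <->
  t = 1%N \/ (2 * k + t <= #|T|)%N /\ ((k < 2 ^ tau)%N \/ is_two_power t).
Proof.
move=> F2 t0 T0 tau_bit tau_least kT; split=> [ex|].
  have [->|t1] := eqVneq t 1%N; [by left | right].
  have {}t1 : (1 < t)%N by lia.
  case: (leqP (2 * k + t) #|T|) => [ktT|Tkt]; last first.
    by case: (not_exact_at_narrow F2 t1 kT Tkt ex).
  split=> //; case: (ltnP k (2 ^ tau)) => tau_k; [by left | right].
  have [//|[c [tau_c ct c_bit]]] := two_power_or_higher_bit t0 tau_least.
  case: (not_exact_at_bits F2 tau_c tau_bit c_bit tau_k _ ex).
  by rewrite cardsT; lia.
case=> [->|[kt cond]].
  by apply: exact_at1; rewrite // -card_gt0 cardsT.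
apply: exact_at_large; rewrite ?cardsT // => u /andP[u0 ut] uk.
(* Either condition gives [u < 2 ^ tau]: from [u <= k < 2 ^ tau], or from [u < t = 2 ^ tau]. Hence
   [2 ^ tau] divides [t] but not [u]. *)
apply: even_bin_dvd2X (least_bit_dvdn tau_least) _.
apply/negP => /(dvdn_leq u0); case: cond => [|/(two_power_least_bit t0 tau_bit tau_least)]; lia.
Qed.

Theorem theorem1p2 (F : fieldType) (hF : 2%N \in [pchar F])
    (t n k : nat) (ht : (0 < t)%N) (hn : (0 < n)%N) (hk : (k <= n)%N)
    (tau : nat) (htau : in_binary_form tau t)
    (htau_least : forall b : nat, in_binary_form b t -> (2 ^ tau <= 2 ^ b)%N) :
  lker (boundary F n k%:Z (k%:Z - t%:Z)) = limg (boundary F n (k%:Z + t%:Z) k%:Z)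
  <->
  [\/ t = 1%N,
      ((k < 2 ^ tau)%N /\ (k + t <= n - k)%N) \/
      ((n - k < 2 ^ tau)%N /\ (n - k + t <= k)%N)
    | is_two_power t /\
      ((2 * k%:Z + t%:Z <= n%:Z) \/ (n%:Z <= 2 * k%:Z - t%:Z)) ].
Proof.
rewrite boundary_exactP //.
have half l := @exact_at_lower_half F 'I_n t l tau hF ht.
rewrite card_ord in half.
have compl l : (l <= n)%N -> exact_at F [set: 'I_n] t l ->
    exact_at F [set: 'I_n] t (n - l).
  by have := @exact_at_compl F 'I_n t l; rewrite card_ord.
(* The second alternatives of (ii) and (iii) require n + t <= 2k, so they are impossible when 2k <=
   n. *)
have [kn|nk] := leqP (2 * k) n.
  rewrite half //; split=> [[|[? [?|?]]]|].
  - by constructor 1.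
  - by constructor 2; left; lia.
  - by constructor 3; split=> //; left; lia.
  - case=> [t1|[[k1 k2]|[k1 k2]]|[t2 k1]]; first by left.
    + by right; split; [lia | left].
    + lia.
    + by right; split; [lia | right].
(* Complementing twice returns to k, so duality gives an equivalence, and n - k lies in the lower
   half. *)
transitivity (exact_at F [set: 'I_n] t (n - k)).
  by split=> /compl; rewrite ?leq_subr ?subKn //; apply.
rewrite half //; last by lia.
split=> [[|[? [?|?]]]|].
- by constructor 1.
- by constructor 2; right; lia.
- by constructor 3; split=> //; right; lia.
- case=> [t1|[[k1 k2]|[k1 k2]]|[t2 k1]]; first by left.
  + lia.
  + by right; split; [lia | left].
  + by right; split; [lia | right].
Qed.
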